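(* Let $K$ be a commutative unital ring, $G$ a group and $\alpha = (G, M, \{M_g\}_{g\in G}, \{\alpha_g\}_{g\in G})$ a (left) partial group action of $G$ on a $K$-module $M$. Let $\Theta$ be the global action of $G$ on $KG\otimes_{G_{par}} M$ given by $\Theta_h(g\otimes_{G_{par}} m)= hg\otimes_{G_{par}} m$, and let $\iota: M\to KG\otimes_{G_{par}} M$ be the map $\iota(m) = 1\otimes_{G_{par}} m$. Then $(\Theta,\iota)$ is the universal global action of $\alpha$.
   Context: $K$ is a fixed commutative unital ring; $\otimes=\otimes_K$; $G$ is a group. A (left) partial action $\alpha=(G,M,\{M_g\},\{\alpha_g\})$ of $G$ on a $K$-module $M$ consists of $K$-submodules $M_g\subseteq M$ and $K$-linear isomorphisms $\alpha_g:M_{g^{-1}}\to M_g$ ($g\in G$) such that (i) $M_1=M$, $\alpha_1=\mathrm{id}_M$; (ii) $\alpha_g(M_{g^{-1}}\cap M_{g^{-1}h})\subseteq M_g\cap M_h$; (iii) $\alpha_g\alpha_h(x)=\alpha_{gh}(x)$ for $x\in M_{h^{-1}}\cap M_{h^{-1}g^{-1}}$. It is global if $M_g=M$ for all $g$, i.e. it is an ordinary $K$-linear $G$-action. A $G$-equivariant map $\phi:M\to N$ between modules with partial actions $\alpha,\beta$ is a $K$-linear map with $\phi(M_g)\subseteq N_g$ and $\phi(\alpha_g(x))=\beta_g(\phi(x))$ for all $g\in G$, $x\in M_{g^{-1}}$. $KG\otimes_{G_{par}}M$ is the quotient of $KG\otimes M$ by the $K$-submodule generated by all $gh\otimes m-g\otimes\alpha_h(m)$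 with $g,h\in G$, $m\in M_{h^{-1}}$; $g\otimes_{G_{par}}m$ is the class of $g\otimes m$. The universal global action of $\alpha$ is a pair $(\theta,\iota)$, where $\theta$ is a global action of $G$ on a $K$-module $W$ and $\iota:M\to W$ is a $G$-equivariant map, such that for every global action of $G$ on a $K$-module $X$ and every $G$-equivariant map $\psi:M\to X$ there is a unique morphism of $G$-modules $\tilde\psi:W\to X$ with $\tilde\psi\circ\iota=\psi$. *)

(* Defs.v *)
From HB Require Import structures.
From mathcomp Require Import all_boot all_algebra.
From mathcomp Require Import finmap.
From mathcomp Require Import boolp.
From mathcomp.multinomials Require Import monalg.

Set Implicit Arguments.
Unset Strict Implicit.
Unset Printing Implicit Defensive.

Import GRing.Theory.
Local Open Scope quotient_scope.
Local Open Scope ring_scope.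

(* [{malg K[X]}] has a [K]-module structure in the library only when [1 != 0]
   in [K]; the alias [freemod] carries one for every ring [K]. *)
Definition freemod (K : pzRingType) (X : choiceType) : Type := {malg K[X]}.

HB.instance Definition _ (K : pzRingType) (X : choiceType) :=
  GRing.Zmodule.on (freemod K X).

(* Locked, so that conversion never unfolds finitely supported functions. *)
HB.lock Definition fm_basis (K : pzRingType) (X : choiceType) (x : X) :
  freemod K X := << 1 *g x >>.

Section FreeModule.
Variables (K : pzRingType) (X : choiceType).
Implicit Types (c : K) (u v : freemod K X).

Definition fm_scale c u : freemod K X :=
  \sum_(x <- msupp u) << c * u@_x *g x >>.

Lemma fm_scaleE c u x : (fm_scale c u)@_x = c * u@_x.
Proof.
rewrite {2}[u](@monalgE X K) !raddf_sum mulr_sumr.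
by apply/eq_bigr=> /= i _; rewrite !mcoeffU mulrnAr.
Qed.

Lemma fm_scaleA a b u : fm_scale a (fm_scale b u) = fm_scale (a * b) u.
Proof. by apply/malgP=> x; rewrite !fm_scaleE mulrA. Qed.

Lemma fm_scale1 : left_id 1 fm_scale.
Proof. by move=> u; apply/malgP=> x; rewrite !fm_scaleE mul1r. Qed.

Lemma fm_scaleDr : right_distributive fm_scale +%R.
Proof.
by move=> c u v; apply/malgP=> x; rewrite !(mcoeffD, fm_scaleE) mulrDr.
Qed.

Lemma fm_scaleDl u : {morph fm_scale^~ u : a b / a + b}.
Proof. by move=> a b; apply/malgP=> x; rewrite !(mcoeffD, fm_scaleE) mulrDl. Qed.

HB.instance Definition _ := GRing.Zmodule_isLmodule.Build K (freemod K X)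
  fm_scaleA fm_scale1 fm_scaleDr fm_scaleDl.

Lemma mcoeff_fmZ c u x : (c *: u)@_x = c * u@_x.
Proof. exact: fm_scaleE. Qed.

Lemma fm_expand u : u = \sum_(x <- msupp u) u@_x *: fm_basis K x.
Proof.
rewrite {1}[u](@monalgE X K) fm_basis.unlock; apply: eq_bigr => x _; apply/malgP=> y.
by rewrite mcoeff_fmZ !mcoeffU mulrnAr mulr1.
Qed.

Section Lift.
Variables (V : lmodType K) (f : X -> V).

Definition fm_lift u : V := \sum_(x <- msupp u) u@_x *: f x.

Lemma fm_liftEw u (D : {fset X}) :
  (msupp u `<=` D)%fset -> fm_lift u = \sum_(x <- D) u@_x *: f x.
Proof.
move=> uD; rewrite /fm_lift; apply: big_fset_incl => // x _ xNu.
by rewrite mcoeff_outdom // scale0r.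
Qed.

Lemma fm_lift_is_linear : linear fm_lift.
Proof.
move=> c u v.
pose D := (msupp u `|` msupp v `|` msupp (c *: u + v : {malg K[X]}))%fset.
rewrite (@fm_liftEw _ D) ?fsubsetUr // (@fm_liftEw u D); last first.
  by rewrite /D -fsetUA fsubsetUl.
rewrite (@fm_liftEw v D); last by rewrite /D fsetUAC fsubsetUr.
rewrite scaler_sumr -big_split /=; apply: eq_bigr => x _.
by rewrite mcoeffD mcoeff_fmZ scalerDl scalerA.
Qed.

HB.instance Definition _ :=
  GRing.isLinear.Build K (freemod K X) V *:%R fm_lift fm_lift_is_linear.

Lemma fm_lift_basis x : fm_lift (fm_basis K x) = f x.
Proof.
rewrite fm_basis.unlock (@fm_liftEw _ [fset x]%fset) ?msuppU_le // big_seq_fset1.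
by rewrite mcoeffUU scale1r.
Qed.

End Lift.
End FreeModule.

Section Quotient.
Variables (K : pzRingType) (V : lmodType K).

(* The submodule generated by [S]: the intersection of all submodules of [V]
   containing [S]. *)
Definition gensubmod (S : V -> Prop) : {pred V} := fun v =>
  `[< forall P : {pred V},
        submod_closed P -> (forall s, S s -> s \in P) -> v \in P >].

Lemma mem_gensubmod (S : V -> Prop) v : S v -> v \in gensubmod S.
Proof. by move=> Sv; apply/asboolP => P _; apply. Qed.

Lemma gensubmod_closed S : submod_closed (gensubmod S).
Proof.
split; first by apply/asboolP => P [P0 _] _.
move=> a u v /asboolP Su /asboolP Sv; apply/asboolP => P PP SP.
by case: (PP) => _; apply; [exact: Su | exact: Sv].
Qed.

HB.instance Definition _ S :=
  GRing.isSubmodClosed.Build K V (gensubmod S) (gensubmod_closed S).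

Variable S : V -> Prop.

Definition qmod : Type := {ideal_quot (gensubmod S)}.

HB.instance Definition _ := GRing.Zmodule.on qmod.

Definition qmod_pi : V -> qmod := \pi_{ideal_quot (gensubmod S)}.

Lemma qmod_pi_is_zmod_morphism : zmod_morphism qmod_pi.
Proof. exact: raddfB. Qed.

HB.instance Definition _ :=
  GRing.isZmodMorphism.Build V qmod qmod_pi qmod_pi_is_zmod_morphism.

Definition qmod_repr (q : qmod) : V := repr q.

Lemma qmod_reprK : cancel qmod_repr qmod_pi.
Proof. exact: reprK. Qed.

Lemma qmod_eqP u v : reflect (qmod_pi u = qmod_pi v) (u - v \in gensubmod S).
Proof. by rewrite Quotient.idealrBE; apply: eqP. Qed.

Definition qmod_scale (a : K) (q : qmod) : qmod := qmod_pi (a *: qmod_repr q).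

Lemma qmod_scaleE a v : qmod_scale a (qmod_pi v) = qmod_pi (a *: v).
Proof.
by apply/qmod_eqP; rewrite -scalerBr rpredZ //; apply/qmod_eqP/qmod_reprK.
Qed.

Lemma qmod_scaleA a b q : qmod_scale a (qmod_scale b q) = qmod_scale (a * b) q.
Proof. by rewrite -[q]qmod_reprK !qmod_scaleE scalerA. Qed.

Lemma qmod_scale1 : left_id 1 qmod_scale.
Proof. by move=> q; rewrite -[q]qmod_reprK qmod_scaleE scale1r. Qed.

Lemma qmod_scaleDr : right_distributive qmod_scale +%R.
Proof.
move=> a p q; rewrite -[p]qmod_reprK -[q]qmod_reprK.
by rewrite -raddfD !qmod_scaleE scalerDr raddfD.
Qed.

Lemma qmod_scaleDl q : {morph qmod_scale^~ q : a b / a + b}.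
Proof.
by move=> a b; rewrite -[q]qmod_reprK !qmod_scaleE scalerDl raddfD.
Qed.

HB.instance Definition _ := GRing.Zmodule_isLmodule.Build K qmod
  qmod_scaleA qmod_scale1 qmod_scaleDr qmod_scaleDl.

Lemma qmod_piZ : scalable qmod_pi.
Proof. by move=> a v; rewrite -qmod_scaleE. Qed.

HB.instance Definition _ :=
  GRing.isScalable.Build K V qmod *:%R qmod_pi qmod_piZ.

Section Lift.
Variables (W : lmodType K) (f : {linear V -> W}).
Hypothesis fS : forall s, S s -> f s = 0.

Lemma gensubmod_ker v : v \in gensubmod S -> f v = 0.
Proof.
move=> /asboolP/(_ [pred u | f u == 0]) H; apply/eqP; apply: H.
  split=> [|a u w]; rewrite !inE ?raddf0 //.
  by move=> /eqP u0 /eqP w0; rewrite linearP u0 w0 scaler0 addr0.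
by move=> s /fS s0; rewrite inE s0.
Qed.

Definition qmod_lift of (forall s, S s -> f s = 0) :=
  fun q : qmod => f (qmod_repr q).

Lemma qmod_liftE v : qmod_lift fS (qmod_pi v) = f v.
Proof.
apply/eqP; rewrite -subr_eq0 -raddfB; apply/eqP/gensubmod_ker.
exact/qmod_eqP/qmod_reprK.
Qed.

Lemma qmod_lift_is_linear : linear (qmod_lift fS).
Proof.
move=> a p q; rewrite -[p]qmod_reprK -[q]qmod_reprK -linearP.
by rewrite !qmod_liftE linearP.
Qed.

HB.instance Definition _ := GRing.isLinear.Build K qmod W *:%R (qmod_lift fS)
  qmod_lift_is_linear.

End Lift.
End Quotient.

Section Tensor.
Variables (K : comPzRingType) (A B : lmodType K).

Local Notation pair_ a b := (fm_basis K (a : A, b : B)).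

Inductive tensor_rel : freemod K (A * B)%type -> Prop :=
| TensorDl a a' b : tensor_rel (pair_ (a + a') b - pair_ a b - pair_ a' b)
| TensorDr a b b' : tensor_rel (pair_ a (b + b') - pair_ a b - pair_ a b')
| TensorZl k a b : tensor_rel (pair_ (k *: a) b - k *: pair_ a b)
| TensorZr k a b : tensor_rel (pair_ a (k *: b) - k *: pair_ a b).

Definition tensor : Type := qmod tensor_rel.

HB.instance Definition _ := GRing.Lmodule.on tensor.

Definition tens (a : A) (b : B) : tensor := qmod_pi tensor_rel (pair_ a b).

Lemma tensDl a a' b : tens (a + a') b = tens a b + tens a' b.
Proof.
rewrite /tens -raddfD; apply/qmod_eqP; rewrite opprD addrA.
exact/mem_gensubmod/TensorDl.
Qed.

Lemma tensDr a b b' : tens a (b + b') = tens a b + tens a b'.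
Proof.
rewrite /tens -raddfD; apply/qmod_eqP; rewrite opprD addrA.
exact/mem_gensubmod/TensorDr.
Qed.

Lemma tensZl k a b : tens (k *: a) b = k *: tens a b.
Proof.
rewrite /tens -qmod_piZ; apply/qmod_eqP.
exact/mem_gensubmod/TensorZl.
Qed.

Lemma tensZr k a b : tens a (k *: b) = k *: tens a b.
Proof.
rewrite /tens -qmod_piZ; apply/qmod_eqP.
exact/mem_gensubmod/TensorZr.
Qed.

End Tensor.

Notation "A ⊗[ K ] B" := (@tensor K A B)
  (at level 40, K at level 200, format "A  ⊗[ K ]  B") : type_scope.

Section TensorMapL.
Variables (K : comPzRingType) (A A' B : lmodType K) (f : {linear A -> A'}).

Definition tensor_mapl_pre : freemod K (A * B)%type -> A' ⊗[K] B :=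
  fm_lift (fun p : A * B => tens (f p.1) p.2).

HB.instance Definition _ := GRing.Linear.on tensor_mapl_pre.

Lemma tensor_mapl_rel s : @tensor_rel K A B s -> tensor_mapl_pre s = 0.
Proof.
case=> *; rewrite !(raddfB, linearZ) /= /tensor_mapl_pre !fm_lift_basis /=.
- by rewrite raddfD tensDl -addrA -opprD subrr.
- by rewrite tensDr -addrA -opprD subrr.
- by rewrite linearZ tensZl [fm_lift _ _]linearZ /= fm_lift_basis subrr.
- by rewrite tensZr [fm_lift _ _]linearZ /= fm_lift_basis subrr.
Qed.

Definition tensor_mapl : A ⊗[K] B -> A' ⊗[K] B := qmod_lift tensor_mapl_rel.

HB.instance Definition _ := GRing.Linear.on tensor_mapl.

Lemma tensor_maplE a b : tensor_mapl (tens a b) = tens (f a) b.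
Proof.
by rewrite /tensor_mapl /tens qmod_liftE /= /tensor_mapl_pre fm_lift_basis.
Qed.

End TensorMapL.

Lemma tensor_linear_ext (K : comPzRingType) (A B W : lmodType K)
    (f g : {linear A ⊗[K] B -> W}) :
  (forall a b, f (tens a b) = g (tens a b)) -> f =1 g.
Proof.
move=> fg t; rewrite -[t]qmod_reprK [qmod_repr t]fm_expand.
rewrite !raddf_sum; apply: eq_bigr => -[a b] _.
by rewrite /= qmod_piZ !linearZ; congr (_ *: _); exact: fg.
Qed.

(* The underlying [K]-module of the group algebra [KG]; its basis element
   attached to [g : G] is [gel K g]. *)
Notation groupalg K G := (freemod K G).
Definition gel (K : pzRingType) (G : groupType) (g : G) : groupalg K G :=
  fm_basis K g.

(* Boolean predicates are no restriction on submodules: [gensubmod] already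
   uses the classical axioms, under which any [Prop]-valued predicate is
   boolean.
   [pa_act alpha g] is a total function on [M], but only its restriction to
   the submodule [pa_dom alpha g^-1] is meaningful; the fields [pa_linear],
   [pa_maps], [pa_inj] and [pa_surj] say that this restriction is a linear
   isomorphism onto [pa_dom alpha g]. *)
Record partial_action (K : comPzRingType) (G : groupType) (M : lmodType K) :=
  PartialAction {
    pa_dom : G -> {pred M};
    pa_act : G -> M -> M;
    pa_submod : forall g, submod_closed (pa_dom g);
    pa_linear : forall g (a : K), {in pa_dom g^-1%g &, forall x y,
      pa_act g (a *: x + y) = a *: pa_act g x + pa_act g y};
    pa_maps : forall g, {in pa_dom g^-1%g, forall x, pa_act g x \in pa_dom g};
    pa_inj : forall g, {in pa_dom g^-1%g &, injective (pa_act g)};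
    pa_surj : forall g, {in pa_dom g, forall y,
      exists2 x, x \in pa_dom g^-1%g & pa_act g x = y};
    pa_dom1 : forall x, x \in pa_dom 1%g;
    pa_act1 : forall x, pa_act 1%g x = x;
    pa_capt : forall g h x,
      x \in pa_dom g^-1%g -> x \in pa_dom (g^-1 * h)%g ->
      pa_act g x \in pa_dom g /\ pa_act g x \in pa_dom h;
    pa_actM : forall g h x,
      x \in pa_dom h^-1%g -> x \in pa_dom (h^-1 * g^-1)%g ->
      pa_act g (pa_act h x) = pa_act (g * h)%g x
  }.

Definition pa_global (K : comPzRingType) (G : groupType) (M : lmodType K)
    (alpha : partial_action G M) : Prop :=
  forall g x, x \in pa_dom alpha g.

Section GlobalAction.
Variables (K : comPzRingType) (G : groupType) (M : lmodType K).
Variable act : G -> {linear M -> M}.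
Hypothesis act1 : forall x, act 1%g x = x.
Hypothesis actM : forall g h x, act g (act h x) = act (g * h)%g x.

Fact global_submod (g : G) : submod_closed (predT : {pred M}).
Proof. by []. Qed.

Fact global_linear g (a : K) : {in (predT : {pred M}) &, forall x y,
  act g (a *: x + y) = a *: act g x + act g y}.
Proof. by move=> x y _ _; rewrite linearP. Qed.

Fact global_maps g : {in (predT : {pred M}), forall x, act g x \in predT}.
Proof. by []. Qed.

Fact global_inj g : {in (predT : {pred M}) &, injective (act g)}.
Proof.
move=> x y _ _ /(congr1 (act g^-1%g)).
by rewrite !actM mulVg !act1.
Qed.

Fact global_surj g : {in (predT : {pred M}), forall y,
  exists2 x, x \in (predT : {pred M}) & act g x = y}.
Proof. by move=> y _; exists (act g^-1%g y); rewrite // actM mulgV act1. Qed.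

Definition global_action : partial_action G M :=
  PartialAction (pa_dom := fun _ => predT)
    global_submod global_linear global_maps global_inj global_surj
    (fun _ => isT) act1
    (fun _ _ _ _ _ => conj isT isT) (fun g h x _ _ => actM g h x).

End GlobalAction.

Definition equivariant (K : comPzRingType) (G : groupType) (M N : lmodType K)
    (alpha : partial_action G M) (beta : partial_action G N)
    (phi : {linear M -> N}) : Prop :=
  (forall g, {in pa_dom alpha g, forall x, phi x \in pa_dom beta g}) /\
  (forall g, {in pa_dom alpha g^-1%g, forall x,
     phi (pa_act alpha g x) = pa_act beta g (phi x)}).

(* Morphisms of [G]-modules are the equivariant maps between global actions. *)
Definition universal_global_action
    (K : comPzRingType) (G : groupType) (M : lmodType K)
    (alpha : partial_action G M)
    (W : lmodType K) (theta : partial_action G W) (iota : {linear M -> W}) :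
    Prop :=
  [/\ pa_global theta,
      equivariant alpha theta iota &
      forall (X : lmodType K) (xi : partial_action G X) (psi : {linear M -> X}),
        pa_global xi -> equivariant alpha xi psi ->
        exists psit : {linear W -> X},
          [/\ equivariant theta xi psit,
              forall m, psit (iota m) = psi m &
              forall psit' : {linear W -> X},
                equivariant theta xi psit' ->
                (forall m, psit' (iota m) = psi m) ->
                psit' =1 psit]].

Section ParTensor.
Variables (K : comPzRingType) (G : groupType) (M : lmodType K).
Variable alpha : partial_action G M.

Inductive partensor_rel : groupalg K G ⊗[K] M -> Prop :=
| ParTensorRel g h m : m \in pa_dom alpha h^-1%g ->
    partensor_rel
      (tens (gel K (g * h)%g) m - tens (gel K g) (pa_act alpha h m)).

Definition partensor : Type := qmod partensor_rel.

HB.instance Definition _ := GRing.Lmodule.on partensor.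

Definition ptens (g : G) (m : M) : partensor :=
  qmod_pi partensor_rel (tens (gel K g) m).

Lemma ptensM g h m : m \in pa_dom alpha h^-1%g ->
  ptens (g * h)%g m = ptens g (pa_act alpha h m).
Proof. by move=> mD; apply/qmod_eqP/mem_gensubmod/ParTensorRel. Qed.

Lemma ptens_is_linear g : linear (ptens g).
Proof. by move=> a x y; rewrite /ptens tensDr tensZr linearP. Qed.

HB.instance Definition _ g :=
  GRing.isLinear.Build K M partensor *:%R (ptens g) (ptens_is_linear g).

Lemma partensor_ext (W : lmodType K) (f g : {linear partensor -> W}) :
  (forall x m, f (ptens x m) = g (ptens x m)) -> f =1 g.
Proof.
move=> fg q; rewrite -[q]qmod_reprK.
apply: (tensor_linear_ext (f := f \o qmod_pi partensor_rel)
                          (g := g \o qmod_pi partensor_rel)) => u m /=.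
have tens_lin : linear (fun a : groupalg K G => tens a m).
  by move=> a x y; rewrite tensDl tensZl.
pose tl : {linear groupalg K G -> groupalg K G ⊗[K] M} :=
  HB.pack (fun a : groupalg K G => tens a m)
    (GRing.isLinear.Build _ _ _ _ _ tens_lin).
rewrite -[tens u m]/(tl u) [u]fm_expand !raddf_sum.
apply: eq_bigr => x _; rewrite /= tensZl !qmod_piZ !linearZ.
by congr (_ *: _); exact: fg.
Qed.

Definition gmull (h : G) : groupalg K G -> groupalg K G :=
  fm_lift (fun g => gel K (h * g)%g).

HB.instance Definition _ h := GRing.Linear.on (gmull h).

Lemma gmullE h g : gmull h (gel K g) = gel K (h * g)%g.
Proof. exact: fm_lift_basis. Qed.

Definition Theta_pre (h : G) : groupalg K G ⊗[K] M -> partensor :=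
  qmod_pi partensor_rel \o tensor_mapl (gmull h).

HB.instance Definition _ h := GRing.Linear.on (Theta_pre h).

Lemma Theta_preE h g m : Theta_pre h (tens (gel K g) m) = ptens (h * g)%g m.
Proof. by rewrite /Theta_pre /= tensor_maplE /= gmullE. Qed.

Lemma Theta_pre_rel h s : partensor_rel s -> Theta_pre h s = 0.
Proof.
by case=> g k m mD; rewrite raddfB /= !Theta_preE mulgA (ptensM _ mD) subrr.
Qed.

Definition Theta_act (h : G) : partensor -> partensor :=
  qmod_lift (@Theta_pre_rel h).

HB.instance Definition _ h := GRing.Linear.on (Theta_act h).

Lemma Theta_actE h g m : Theta_act h (ptens g m) = ptens (h * g)%g m.
Proof.
by rewrite /Theta_act /ptens qmod_liftE /= Theta_preE.
Qed.

Lemma Theta_act1 x : Theta_act 1%g x = x.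
Proof.
by apply: (partensor_ext (f := Theta_act 1%g) (g := idfun)) => g m; rewrite /= Theta_actE mul1g.
Qed.

Lemma Theta_actM g h x : Theta_act g (Theta_act h x) = Theta_act (g * h)%g x.
Proof.
apply: (partensor_ext (f := Theta_act g \o Theta_act h)) => k m /=.
by rewrite !Theta_actE mulgA.
Qed.

Definition Theta : partial_action G partensor :=
  global_action Theta_act1 Theta_actM.

Definition iota_par : M -> partensor := ptens 1%g.

HB.instance Definition _ := GRing.Linear.on iota_par.

End ParTensor.

(* Main.v *)
Require Import Defs.
From HB Require Import structures.
From mathcomp Require Import all_boot all_algebra.

(** The relations that define [partensor alpha] are exactly what is needed for
    a family of linear maps [f g : M -> X] to factor through the classes
    [ptens alpha g m]: such a family descends as soon as it is balanced, i.e.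
    [f (g * h) m = f g (alpha_h m)] whenever [alpha_h m] is defined
    ([partensor_lift]).

    Let [xi] be a global action on [X] and [psi : M -> X] an equivariant map.
    The only possible value of a [G]-morphism extending [psi] is
    [xi_g (psi m)] at [ptens alpha g m = Theta_g (iota m)], and the classes
    [ptens alpha g m] span, which gives uniqueness.  For existence, the family
    [f g := xi_g \o psi] is balanced:
    [xi_(g * h) (psi m) = xi_g (xi_h (psi m)) = xi_g (psi (alpha_h m))],
    by the action law of [xi] and the equivariance of [psi].  The descended map
    commutes with the two actions because both sides are linear and agree on
    the classes [ptens alpha g m].  Finally, [iota] is equivariant because
    [1 * h = h * 1]: the relation for the former product yields
    [iota (alpha_h m) = ptens alpha h m = Theta_h (iota m)]. *)

Set Implicit Arguments.
Unset Strict Implicit.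
Unset Printing Implicit Defensive.

Import GRing.Theory.
Local Open Scope ring_scope.

Lemma tensor_lift (K : comPzRingType) (A B W : lmodType K) (b : A -> B -> W) :
    (forall y, linear (b^~ y)) -> (forall x, linear (b x)) ->
  exists f : {linear A ⊗[K] B -> W}, forall x y, f (tens x y) = b x y.
Proof.
move=> bl br.
have [pre preE] : exists pre : {linear freemod K (A * B)%type -> W},
    forall x y, pre (fm_basis K (x, y)) = b x y.
  by exists (fm_lift (fun p => b p.1 p.2)) => x y; exact: fm_lift_basis.
have preB u v : pre (u - v) = pre u - pre v by exact: raddfB.
have preZ k u : pre (k *: u) = k *: pre u by exact: linearZ.
have blD y x x' : b (x + x') y = b x y + b x' y.
  by have := bl y 1 x x'; rewrite !scale1r.
have brD x y y' : b x (y + y') = b x y + b x y'.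
  by have := br x 1 y y'; rewrite !scale1r.
have bl0 y : b 0 y = 0 by apply: (addrI (b 0 y)); rewrite -blD !addr0.
have br0 x : b x 0 = 0 by apply: (addrI (b x 0)); rewrite -brD !addr0.
have pre_rel s : @tensor_rel K A B s -> pre s = 0.
  case=> [x x' y|x y y'|k x y|k x y]; rewrite !preB ?preZ !preE.
  - by rewrite blD -addrA -opprD subrr.
  - by rewrite brD -addrA -opprD subrr.
  - by rewrite -[k *: x]addr0 bl bl0 addr0 subrr.
  - by rewrite -[k *: y]addr0 br br0 addr0 subrr.
exists (qmod_lift pre_rel) => x y.
by rewrite -preE; exact: qmod_liftE.
Qed.

(** A family of linear maps indexed by [G] is extended to [KG] in its index and
    so becomes a bilinear map out of [KG * M]; the balancing condition says
    that the induced map on [KG ⊗ M] kills the relations of [partensor]. *)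
Lemma partensor_lift (K : comPzRingType) (G : groupType) (M X : lmodType K)
    (alpha : partial_action G M) (f : G -> M -> X) :
    (forall g, linear (f g)) ->
    (forall g h m, m \in pa_dom alpha h^-1%g ->
       f (g * h)%g m = f g (pa_act alpha h m)) ->
  exists F : {linear partensor alpha -> X},
    forall g m, F (ptens alpha g m) = f g m.
Proof.
move=> flin fbal.
pose b (u : groupalg K G) m := fm_lift (f^~ m) u.
have bE g m : b (gel K g) m = f g m by exact: fm_lift_basis.
have [|u|F FE] := @tensor_lift K (groupalg K G) M X b.
- by move=> m; exact: fm_lift_is_linear.
- move=> a x y; rewrite /b /fm_lift scaler_sumr -big_split /=.
  by apply: eq_bigr => g _; rewrite flin scalerDr !scalerA [a * _]mulrC.
have F_rel s : partensor_rel alpha s -> F s = 0.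
  by case=> g h m mD; rewrite raddfB /= !FE !bE fbal // subrr.
exists (qmod_lift F_rel) => g m.
by rewrite -bE -FE; exact: qmod_liftE.
Qed.

Lemma pa_act_linear (K : comPzRingType) (G : groupType) (M : lmodType K)
    (alpha : partial_action G M) :
  pa_global alpha -> forall g, linear (pa_act alpha g).
Proof. by move=> glob g a x y; rewrite pa_linear // glob. Qed.

Lemma iota_par_equivariant (K : comPzRingType) (G : groupType)
    (M : lmodType K) (alpha : partial_action G M) :
  equivariant alpha (Theta alpha) (iota_par alpha).
Proof.
split=> // g m mD.
by rewrite /= /iota_par -ptensM // mul1g Theta_actE mulg1.
Qed.

(** A [G]-morphism out of [partensor alpha] is forced on the spanning classes,
    since [ptens alpha g m] is the translate by [g] of [iota_par alpha m]. *)
Lemma equivariant_ptens (K : comPzRingType) (G : groupType)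
    (M X : lmodType K) (alpha : partial_action G M) (xi : partial_action G X)
    (F : {linear partensor alpha -> X}) :
  equivariant (Theta alpha) xi F ->
  forall g m, F (ptens alpha g m) = pa_act xi g (F (iota_par alpha m)).
Proof.
by move=> [_ FG] g m; rewrite -FG //= /iota_par Theta_actE mulg1.
Qed.

Theorem theorem2p26 (K : comPzRingType) (G : groupType) (M : lmodType K)
    (alpha : partial_action G M) :
  (forall (h g : G) (m : M),
     pa_act (Theta alpha) h (ptens alpha g m) = ptens alpha (h * g)%g m) /\
  (forall m : M, iota_par alpha m = ptens alpha 1%g m) /\
  universal_global_action alpha (Theta alpha) (iota_par alpha).
Proof.
split; first by move=> h g m; exact: Theta_actE.
split=> //; split=> //; first exact: iota_par_equivariant.
move=> X xi psi xi_glob [_ psiG].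
have xiM g h x : pa_act xi g (pa_act xi h x) = pa_act xi (g * h)%g x.
  by rewrite pa_actM // xi_glob.
have [||F FE] := @partensor_lift K G M X alpha (fun g m => pa_act xi g (psi m)).
- by move=> g a x y; rewrite linearP pa_act_linear.
- by move=> g h m mD; rewrite -xiM psiG.
have Fiota m : F (iota_par alpha m) = psi m by rewrite /iota_par FE pa_act1.
exists F; split=> //.
- split=> [g x _|h x _]; first exact: xi_glob.
  (* Packing [xi_h] as a linear map lets both sides be compared on the
     classes [ptens alpha g m] alone. *)
  pose xih : {linear X -> X} := HB.pack (pa_act xi h)
    (GRing.isLinear.Build _ _ _ _ _ (pa_act_linear xi_glob h)).
  apply: (partensor_ext (f := F \o Theta_act h) (g := xih \o F)) => g m /=.
  by rewrite Theta_actE !FE xiM.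
- move=> F' F'G F'iota; apply: partensor_ext => g m.
  by rewrite (equivariant_ptens F'G) F'iota FE.
Qed.
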